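(* Let $k\geq e\geq 1$ be integers. Set $\varepsilon_0=2^e$ and, for $1\leq j\leq e$, set $$\varepsilon_j=2^{e-j}v_1^{2^{j-1}(k-e+3)-2}\in ku_* .$$ Then $\varepsilon_j\cdot\tau_{k,e}=0$ for $j=0,1,\ldots,e$.
   Context: $ku$ is the connective cover of complex $K$-theory, $ku_*=\mathbb{Z}[v_1]$ with $v_1\in ku_2$ corresponding to Bott periodicity, and $ku_*X$ denotes the reduced $ku$-homology of $X$. The projection $\mathbb{Z}\times\mathbb{Z}\to\mathbb{Z}_{2^k}\times\mathbb{Z}_{2^e}$ induces a map $S^1\times S^1\to B(\mathbb{Z}_{2^k}\times\mathbb{Z}_{2^e})$ of classifying spaces; composing with the stable inclusion of the top cell $S^2$ of the torus gives a stable map $S^2\to B(\mathbb{Z}_{2^k}\times\mathbb{Z}_{2^e})$. The toral class $\tau_{k,e}\in ku_2B(\mathbb{Z}_{2^k}\times\mathbb{Z}_{2^e})$ is the corresponding image of the canonical generator of $ku_2S^2$. It lies in the $ku_*$-direct summand $ku_*B\mathbb{Z}_{2^k}\otimes_{ku_*}ku_*B\mathbb{Z}_{2^e}$, where it is the tensor product of the two bottom (degree one) classes. Explicitly, for $r\ge1$ let $ku_*(r)$ be the reduced $ku$-homology of $\Sigma^{-1}B\mathbb{Z}_{2^r}$; it is the $ku_*$-module generated by elements $(i)$ of degree $2i$, $i\geq0$, subject to the relations $\sum_{s=0}^{2^r-1}\binom{2^r}{s+1}v_1^s\,(i-s)=0$ for $i\geq0$, where $(\ell)=0$ for $\ell<0$.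 After desuspending twice, the summand above is $ku_*(k)\otimes_{ku_*}ku_*(e)$ and $\tau_{k,e}$ corresponds to $(0)\otimes(0)$. *)

(* Defs.v *)
From HB Require Import structures.
From mathcomp Require Import all_boot all_algebra ring_quotient.
From mathcomp Require Import boolp classical_sets.
From mathcomp.multinomials Require Import freeg.

Set Implicit Arguments.
Unset Strict Implicit.
Unset Printing Implicit Defensive.

Import GRing.Theory.
Local Open Scope classical_set_scope.
Local Open Scope ring_scope.
Local Open Scope quotient_scope.

Section QuotientBySpan.
Variables (R : nzRingType) (M : lmodType R) (G : set M).

Definition submod_span : {pred M} := fun x =>
  `[< exists s : seq (R * M),
      (forall p, p \in s -> G p.2) /\ x = \sum_(p <- s) p.1 *: p.2 >].

Lemma span_submod : submod_closed submod_span.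
Proof.
split; first by apply/asboolP; exists [::]; rewrite big_nil.
move=> a x y /asboolP[s [sG ->]] /asboolP[t [tG ->]]; apply/asboolP.
exists ([seq (a * p.1, p.2) | p <- s] ++ t); split.
  by move=> p; rewrite mem_cat => /orP[/mapP[q /sG ? ->]|/tG].
rewrite big_cat big_map scaler_sumr; congr (_ + _).
by apply: eq_bigr => p _; rewrite scalerA.
Qed.

HB.instance Definition _ := GRing.isSubmodClosed.Build R M submod_span span_submod.

Lemma mem_span x : G x -> x \in submod_span.
Proof.
move=> Gx; apply/asboolP; exists [:: (1, x)].
by split=> [p|]; [rewrite inE => /eqP-> | rewrite big_seq1 scale1r].
Qed.

Definition quot_span : Type := Quotient.quot submod_span.
HB.instance Definition _ := GRing.Zmodule.on quot_span.

Definition quot_proj (x : M) : quot_span := \pi_(Quotient.quot submod_span) x.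

Lemma quot_projP x y : reflect (quot_proj x = quot_proj y) (x - y \in submod_span).
Proof. by rewrite Quotient.idealrBE; apply: eqP. Qed.

Lemma quot_proj_surj (q : quot_span) : {x | q = quot_proj x}.
Proof. by exists (repr q); rewrite /quot_proj reprK. Qed.

Lemma quot_projD : {morph quot_proj : x y / x + y}.
Proof. by move=> x y; rewrite /quot_proj raddfD. Qed.

Definition quot_scale (a : R) (q : quot_span) : quot_span :=
  quot_proj (a *: repr q).

Lemma quot_scaleE a x : quot_scale a (quot_proj x) = quot_proj (a *: x).
Proof.
apply/quot_projP; rewrite -scalerBr; apply: rpredZ.
by apply/quot_projP; rewrite /quot_proj reprK.
Qed.

Fact quot_scaleA a b q : quot_scale a (quot_scale b q) = quot_scale (a * b) q.
Proof. by have [x ->] := quot_proj_surj q; rewrite !quot_scaleE scalerA. Qed.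

Fact quot_scale1 : left_id 1 quot_scale.
Proof.
by move=> q; have [x ->] := quot_proj_surj q; rewrite quot_scaleE scale1r.
Qed.

Fact quot_scaleDr : right_distributive quot_scale +%R.
Proof.
move=> a p q; have [x ->] := quot_proj_surj p.
have [y ->] := quot_proj_surj q.
by rewrite -quot_projD !quot_scaleE scalerDr quot_projD.
Qed.

Fact quot_scaleDl q : {morph quot_scale^~ q : a b / a + b}.
Proof.
move=> a b; have [x ->] := quot_proj_surj q.
by rewrite !quot_scaleE scalerDl quot_projD.
Qed.

HB.instance Definition _ := GRing.Zmodule_isLmodule.Build R quot_span
  quot_scaleA quot_scale1 quot_scaleDr quot_scaleDl.

Fact quot_proj_linear : linear quot_proj.
Proof. by move=> a x y; rewrite quot_projD -quot_scaleE. Qed.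

HB.instance Definition _ :=
  GRing.isLinear.Build R M quot_span *:%R quot_proj quot_proj_linear.

End QuotientBySpan.

Section Tensor.
Variables (R : comNzRingType) (M N : lmodType R).

Let pr (m : M) (n : N) : {freeg (M * N) / R} := << (m, n) >>.

Definition tensor_rel : set {freeg (M * N) / R} :=
  [set z | (exists a m m' n, z = pr (a *: m + m') n - (a *: pr m n + pr m' n)) \/
           (exists a m n n', z = pr m (a *: n + n') - (a *: pr m n + pr m n'))].

Definition tensor : lmodType R := quot_span tensor_rel.

Definition tens (m : M) (n : N) : tensor := quot_proj tensor_rel (pr m n).

Lemma tens_linearl n : linear (tens^~ n).
Proof.
move=> a m m'; rewrite /tens -linearP; apply/quot_projP/mem_span.
by left; exists a, m, m', n.
Qed.

Lemma tens_linearr m : linear (tens m).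
Proof.
move=> a n n'; rewrite /tens -linearP; apply/quot_projP/mem_span.
by right; exists a, m, n, n'.
Qed.

End Tensor.

(* The coefficient ring $ku_* = \mathbb{Z}[v_1]$; gradings are forgotten. *)
Notation ku_coef := {poly int}.
Notation v1 := ('X : ku_coef).

Section KuModule.
Variable r : nat.

Definition ku_free_gen (l : int) : {freeg nat / ku_coef} :=
  if l is Posz n then << n >> else 0.

Definition ku_rel : set {freeg nat / ku_coef} :=
  [set \sum_(s < 2 ^ r)
         ('C(2 ^ r, s.+1)%:R * v1 ^+ s) *: ku_free_gen (i%:Z - s%:Z)
     | i in [set: nat]].

(* Reduced ku-homology of $\Sigma^{-1} B\mathbb{Z}_{2^r}$. *)
Definition ku_mod : lmodType ku_coef := quot_span ku_rel.

Definition ku_gen (i : nat) : ku_mod := quot_proj ku_rel << i >>.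

End KuModule.

(* The summand of $ku_* B(\mathbb{Z}_{2^k} \times \mathbb{Z}_{2^e})$ that
   contains the toral class, desuspended twice. *)
Definition toral_summand (k e : nat) : lmodType ku_coef :=
  tensor (ku_mod k) (ku_mod e).

Definition toral (k e : nat) : toral_summand k e :=
  tens (ku_gen k 0) (ku_gen e 0).

Definition eps (k e j : nat) : ku_coef :=
  if j == 0%N then (2 ^ e)%:R
  else (2 ^ (e - j))%:R * v1 ^+ (2 ^ (j - 1) * (k - e + 3) - 2).

(* Main.v *)
Require Import Defs.
From mathcomp Require Import all_boot all_algebra.
From mathcomp Require Import all_order qpoly ring zify.
From mathcomp.multinomials Require Import freeg.

(* Let X and Y be v_1 times the operators lowering the index of a generator in
   the two factors, so that the relations are multiplication by
   ((1 + X)^(2^k) - 1)/X and ((1 + Y)^(2^e) - 1)/Y. By duality over Z, the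
   statement in degree n becomes: if A and B are integral and
     ((1 + X)^(2^k) - 1)/X * A = ((1 + Y)^(2^e) - 1)/Y * B  mod (X, Y)^(n+1),
   then 2^j divides A(0, 0).
   Fix 1 <= i <= j, a primitive 2^i-th root of unity zeta, and pi = zeta - 1, so
   that 2 is a unit times pi^g with g = 2^(i-1). Substituting (pi X, pi Y) for
   (X, Y) makes the coefficients of degree d divisible by pi^d. Dividing by the
   powers of pi common to both sides leaves polynomials whose degree modulo
   pi^((j-i+1)g) is at most n, so that the truncated congruence is an exact one.
   Evaluating at Y = pi kills the right-hand side and gives
   2^(j-i+1) | A(0, pi). These divisibilities for i = 1, ..., j give
   2^j | A(0, 0), by induction on j. *)

Set Implicit Arguments.
Unset Strict Implicit.
Unset Printing Implicit Defensive.

Import Order.TTheory GRing.Theory Num.Theory.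
Local Open Scope ring_scope.

(** * Regular elements, and polynomials of bounded degree modulo [c] *)

Definition regular (R : comNzRingType) (c : R) := forall a, c * a = 0 -> a = 0.

Lemma regularI (R : comNzRingType) (c a b : R) :
  regular c -> c * a = c * b -> a = b.
Proof.
move=> rc eab; apply/eqP; rewrite -subr_eq0; apply/eqP/rc.
by rewrite mulrBr eab subrr.
Qed.

Section RegularElement.
Variable R : comNzRingType.
Implicit Types (c d : R) (N n : nat) (p q : {poly R}).

Lemma regularX c n : regular c -> regular (c ^+ n).
Proof.
move=> rc; elim: n => [|n IH] a; first by rewrite expr0 mul1r.
by rewrite exprS -mulrA => /rc/IH.
Qed.

Lemma regular_polyC c : regular c -> regular c%:P.
Proof.
move=> rc p; rewrite mul_polyC => cp0; apply/polyP => i.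
by rewrite coef0; apply: rc; rewrite -coefZ cp0 coef0.
Qed.

Lemma regular_scaleI c p q : regular c -> c *: p = c *: q -> p = q.
Proof. by move=> rc; rewrite -!mul_polyC; apply/regularI/regular_polyC. Qed.

Lemma size_regular_scale c p : regular c -> size (c *: p) = size p.
Proof.
move=> rc; have [->|p0] := eqVneq p 0; first by rewrite scaler0.
have cl0 : c * lead_coef p != 0.
  by apply: contra_neq p0 => /rc /eqP; rewrite lead_coef_eq0 => /eqP.
apply/eqP; rewrite eqn_leq size_scale_leq /= leqNgt; apply: contra_neqN cl0.
rewrite lead_coefE -coefZ => lt; rewrite nth_default // -ltnS prednK //.
by rewrite size_poly_gt0.
Qed.

Lemma scale_dvdXn c N p q : regular c -> c *: p = q * 'X^N ->
  exists p', p = p' * 'X^N.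
Proof.
move=> rc e; exists (drop_poly N p); rewrite -[LHS](poly_take_drop N).
suff -> : take_poly N p = 0 by rewrite add0r.
apply: (@regular_scaleI c) => //.
by rewrite -take_polyZ e scaler0 take_polyMXn_0.
Qed.

(* Division by a monic polynomial commutes with scaling, so a factor that is
   monic modulo c can be cancelled from multiples of c. *)
Lemma monic_mod_cancel c m p q v : m \is monic ->
  (m + c *: p) * q = c *: v -> exists q', q = c *: q'.
Proof.
move=> mm e; exists (Pdiv.Ring.rdivp (v - p * q) m).
have {}e : q * m = c *: (v - p * q).
  by rewrite scalerBr -e mulrDl -scalerAl mulrC addrK.
rewrite -[LHS](Pdiv.RingMonic.rdivp_mull mm) e.
rewrite {1}(Pdiv.RingMonic.rdivp_eq mm (v - p * q)) scalerDr scalerAl.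
rewrite Pdiv.RingMonic.rdivp_addl_mul_small //.
apply: leq_ltn_trans (size_scale_leq _ _) _.
by rewrite Pdiv.Ring.ltn_rmodp monic_neq0.
Qed.

(** The image of [p] over R/c has degree less than [N]; an explicit decomposition avoids forming
    R/c. *)
Definition size_mod c N p := exists p0 p1, p = p0 + c *: p1 /\ (size p0 <= N)%N.

Lemma size_mod_le c N N' p : (N <= N')%N -> size_mod c N p -> size_mod c N' p.
Proof.
by move=> le [p0 [p1 [-> s]]]; exists p0, p1; split; rewrite ?(leq_trans s).
Qed.

Lemma size_mod_size c N p : (size p <= N)%N -> size_mod c N p.
Proof. by exists p, 0; rewrite scaler0 addr0. Qed.

Lemma size_modZ c d N p : size_mod c N p -> size_mod c N (d *: p).
Proof.
move=> [p0 [p1 [-> s]]]; exists (d *: p0), (d *: p1).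
rewrite scalerDr !scalerA mulrC; split=> //.
exact: leq_trans (size_scale_leq _ _) s.
Qed.

Lemma size_modD c N p q :
  size_mod c N p -> size_mod c N q -> size_mod c N (p + q).
Proof.
move=> [p0 [p1 [-> s]]] [q0 [q1 [-> t]]]; exists (p0 + q0), (p1 + q1).
rewrite scalerDr addrACA; split=> //.
by rewrite (leq_trans (size_polyD _ _)) // geq_max s t.
Qed.

Lemma size_modN c N p : size_mod c N p -> size_mod c N (- p).
Proof. by rewrite -scaleN1r; apply: size_modZ. Qed.

Lemma size_modM c N N' p q : size_mod c N.+1 p -> size_mod c N' q ->
  size_mod c (N + N') (p * q).
Proof.
move=> [p0 [p1 [-> s]]] [q0 [q1 [-> t]]].
exists (p0 * q0), (p0 * q1 + p1 * (q0 + c *: q1)); split.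
  by rewrite -!mul_polyC; ring.
apply: leq_trans (size_polyMleq _ _) _.
by rewrite -ltnS; case: (size p0 + size q0)%N (leq_add s t).
Qed.

Lemma size_mod_cancel c d N p : regular c -> size_mod (c * d) N (c *: p) ->
  size_mod d N p.
Proof.
move=> rc [p0 [p1 [e s]]]; exists (p - d *: p1), p1.
split; first by rewrite subrK.
by rewrite -(size_regular_scale _ rc) scalerBr e scalerA addrK.
Qed.

(** Modulo [c], [p] is a multiple of ['X^N] of degree less than [N], hence zero. *)
Lemma size_mod_trunc c N p q v : size_mod c N p -> p = q * 'X^N + c *: v ->
  exists p', p = c *: p'.
Proof.
move=> [p0 [p1 [-> s]]] e; exists (take_poly N (v - p1) + p1).
rewrite scalerDr; congr (_ + _).
rewrite -[LHS](take_poly_id s) -take_polyZ scalerBr.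
rewrite -[c *: v](addKr (q * 'X^N)) -e.
by rewrite addrA addrK take_polyD linearN /= take_polyMXn_0 oppr0 add0r.
Qed.

Lemma size_mod_comp d p n : size_mod (d ^+ n) n (p \Po (d *: 'X)).
Proof.
exists (take_poly n p \Po (d *: 'X)), ((drop_poly n p \Po (d *: 'X)) * 'X^n).
split.
  rewrite -{1}(poly_take_drop n p) comp_polyD comp_polyM comp_Xn_poly.
  by rewrite exprZn scalerAr.
case: n => [|n]; first by rewrite take_poly0l comp_poly0 size_poly0.
apply: leq_trans (size_comp_poly_leq _ _) _.
have sX : ((size (d *: 'X : {poly R})).-1 <= 1)%N.
  have := size_scale_leq d ('X : {poly R}); rewrite size_polyX.
  by case: (size _) => [|[]].
have st := size_take_poly n.+1 p.
rewrite ltnS -[leqRHS](muln1 n); apply: leq_mul => //.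
by case: (size _) st.
Qed.

End RegularElement.

(** * Removing powers of [c] from a truncated syzygy *)

Lemma cancelX (R : comNzRingType) (u c : R) d a v : regular c ->
  (forall a v, u * a = c * v -> exists a', a = c * a') ->
  u * a = c ^+ d * v -> exists a', a = c ^+ d * a'.
Proof.
move=> rc cu; elim: d a => [|d IH] a e; first by exists a; rewrite mul1r.
have [a1 ea1] : exists a1, a = c * a1.
  by apply: (cu _ (c ^+ d * v)); rewrite e exprS mulrA.
have [|a2 ea2] := IH a1; last by exists a2; rewrite ea1 ea2 exprS mulrA.
by apply: (regularI rc); rewrite [RHS]mulrA -exprS -e ea1 mulrCA.
Qed.

(** First [c ^+ M] is shown to divide [B], one factor [c] at a time. After division both products
    have degree less than [N] modulo [c ^+ d], so their difference vanishes there. At 1, where [b]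
    vanishes, it remains to cancel [a.[1]]. *)
Lemma truncated_syzygy (R : comNzRingType) (c : R) (M d N h h' : nat)
    (a b A B Q m p : {poly R}) :
    regular c -> m \is monic -> b = m + c *: p -> size_mod c h.+1 b ->
    size_mod (c ^+ d) h'.+1 a -> size_mod (c ^+ d) h'.+1 b -> b.[1] = 0 ->
    (forall x v, a.[1] * x = c * v -> exists x', x = c * x') ->
    (forall n, size_mod (c ^+ n) n A) -> (forall n, size_mod (c ^+ n) n B) ->
    (h + M <= N)%N -> (h' + (M + d) <= N)%N ->
    c ^+ M *: (a * A) - b * B = Q * 'X^N ->
  exists x, A.[1] = c ^+ d * x.
Proof.
move=> rc mm eb sb sa sb' b1 ca sA sB lN lN' e.
have rX n : regular (c ^+ n) by exact: regularX.
have dB r : (r <= M)%N -> exists B', B = c ^+ r *: B'.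
  elim: r => [|r IH] ltr; first by exists B; rewrite scale1r.
  have [B' eB] := IH (ltnW ltr).
  suff [B'' eB''] : exists B'', B' = c *: B''.
    by exists B''; rewrite eB eB'' scalerA -exprSr.
  have sB' : size_mod c r.+1 B'.
    by apply: (size_mod_cancel (rX r)); rewrite -exprSr -eB.
  have e1 : c ^+ r *: (c ^+ (M - r) *: (a * A) - b * B') = Q * 'X^N.
    by rewrite -e eB scalerBr scalerA -exprD subnKC ?scalerAr // ltnW.
  have [Q' e2] := scale_dvdXn (rX r) e1.
  (* Since [r < M], the term in [A] still carries a factor [c]. *)
  have e3 : b * B' = (- Q') * 'X^N + c *: (c ^+ (M - r).-1 *: (a * A)).
    rewrite scalerA -exprS prednK ?subn_gt0 // mulNr -e2.
    by rewrite opprB subrK.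
  have sbB : size_mod c N (b * B').
    by apply: size_mod_le (size_modM sb sB'); lia.
  have [V eV] := size_mod_trunc sbB e3.
  by apply: (monic_mod_cancel mm (p := p) (v := V)); rewrite -eb.
have [B' eB] := dB M (leqnn M).
have sB' : size_mod (c ^+ d) (M + d) B'.
  by apply: (size_mod_cancel (rX M)); rewrite -exprD -eB.
have e1 : c ^+ M *: (a * A - b * B') = Q * 'X^N.
  by rewrite -e eB scalerBr -scalerAr.
have [Q' e2] := scale_dvdXn (rX M) e1.
have sT : size_mod (c ^+ d) N (a * A - b * B').
  apply: size_modD; last apply: size_modN.
    by apply: size_mod_le (size_modM sa (sA d)); lia.
  exact: size_mod_le (size_modM sb' sB').
have [|V eV] := size_mod_trunc (q := Q') (v := 0) sT.
  by rewrite scaler0 addr0.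
apply: (@cancelX _ a.[1] _ _ _ V.[1]) => //.
by rewrite -[RHS]hornerZ -eV hornerD hornerN !hornerM b1 mul0r subr0.
Qed.

(* Here [c] is a uniformizer and [g] is the valuation of 2. If
   [u = 1 + c y T], then [u^2 - 1 = (u - 1) * (2 + (u - 1))], where the second
   factor is dominated by [u - 1] as long as [u - 1] has valuation [< g], and by
   2 once it is [> g]. *)
Section PowerSeries.
Variables (R : comNzRingType) (c e e' : R) (i : nat) (y : R).
Let g := (2 ^ i)%N.
Hypotheses (two : 2 = c ^+ g * e) (e1 : e = 1 + c * e').
Let z : {poly R} := y *: 'X.

Let sqr_shift (C : R) (a : {poly R}) :
  (C *: a + 1) ^+ 2 - 1 = (2 * C) *: a + (C * C) *: a ^+ 2.
Proof. by rewrite -!mul_polyC !rmorphM /= (rmorph_nat polyC); ring. Qed.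

Let size_z n : (size (z ^+ n) <= n.+1)%N.
Proof. by rewrite exprZn -(size_polyXn R n) size_scale_leq. Qed.

Lemma two_power_low l : (l <= i)%N -> exists a p : {poly R},
  [/\ (1 + c *: z) ^+ (2 ^ l) - 1 = c ^+ (2 ^ l) *: a,
      a = z ^+ (2 ^ l) + c *: p & (size a <= (2 ^ l).+1)%N].
Proof.
elim: l => [|l IH] ltl.
  exists z, 0; rewrite expn0 !expr1 scaler0 addr0; split=> //.
    by rewrite addrC addKr.
  exact: (size_z 1).
have [a [p [ea eap sa]]] := IH (ltnW ltl).
have lt2 : (2 ^ l < g)%N by rewrite ltn_exp2l.
(* As [2 ^ l < g], [f] is a multiple of [c], and only the square survives modulo [c]. *)
pose f := c ^+ (g - 2 ^ l) * e.
have ef : 2 = c ^+ (2 ^ l) * f by rewrite /f mulrA -exprD subnKC // ltnW.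
exists (f *: a + a ^+ 2).
exists (c ^+ (g - 2 ^ l).-1 * e *: a + 2 *: (z ^+ (2 ^ l) * p) + c *: p ^+ 2).
split.
- rewrite expnSr exprM -(subrK 1 ((1 + c *: z) ^+ (2 ^ l))) ea sqr_shift.
  by rewrite ef scalerDr !scalerA exprM expr2; congr (_ *: _ + _ *: _); ring.
- have -> : f *: a = c *: (c ^+ (g - 2 ^ l).-1 * e *: a).
    by rewrite scalerA mulrA -exprS prednK // subn_gt0.
  rewrite expnSr exprM [in X in _ + X = _]eap.
  by rewrite -!mul_polyC (rmorph_nat polyC); ring.
- apply: leq_trans (size_polyD _ _) _; rewrite geq_max; apply/andP; split.
    apply: leq_trans (size_scale_leq _ _) (leq_trans sa _).
    by rewrite ltnS leq_exp2l.
  rewrite expr2; apply: leq_trans (size_polyMleq _ _) _.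
  by rewrite expnSr muln2 -addnn; lia.
Qed.

(** Squaring the power [2 ^ i] produces two terms of the same order, whence the two leading terms.
    The squaring after stage [l] adds a multiple of [c ^+ (l.+1 * g)], so modulo [c ^+ (D.+1 * g)]
    the degree stops growing after stage [D]. *)
Lemma two_power_high l : exists a p : {poly R},
  [/\ (1 + c *: z) ^+ (2 ^ (i + l.+1)) - 1 = c ^+ (l.+2 * g) *: a,
      a = z ^+ g + z ^+ (2 * g) + c *: p,
      (size a <= (2 * g * 2 ^ l).+1)%N
    & forall D, size_mod (c ^+ (D.+1 * g)) (2 * g * 2 ^ D).+1 a].
Proof.
have g0 : (0 < g)%N by rewrite expn_gt0.
elim: l => [|l [a [p [ea eap sa ma]]]].
  have [a [p [ea eap sa]]] := two_power_low (leqnn i); rewrite -/g in ea eap sa.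
  have s2 : (size (e *: a + a ^+ 2)%R <= (2 * g).+1)%N.
    apply: leq_trans (size_polyD _ _) _; rewrite geq_max; apply/andP; split.
      by apply: leq_trans (size_scale_leq _ _) (leq_trans sa _); lia.
    by rewrite expr2; apply: leq_trans (size_polyMleq _ _) _; lia.
  exists (e *: a + a ^+ 2).
  exists (e' *: a + p + 2 *: (z ^+ g * p) + c *: p ^+ 2); split.
  - rewrite addn1 expnSr -/g exprM -(subrK 1 ((1 + c *: z) ^+ g)) ea sqr_shift.
    rewrite two scalerDr !scalerA mulnC exprM expr2.
    by congr (_ *: _ + _ *: _); ring.
  - rewrite e1 mulnC exprM eap.
    by rewrite -!mul_polyC !(rmorphD, rmorphM, rmorph1) /=; ring.
  - by rewrite muln1.
  - move=> D; apply: size_mod_size; apply: leq_trans s2 _.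
    by rewrite ltnS leq_pmulr // expn_gt0.
set E := c ^+ (l.+1 * g).
have s2 : (size (e *: a + E *: a ^+ 2)%R <= (2 * g * 2 ^ l.+1).+1)%N.
  apply: leq_trans (size_polyD _ _) _; rewrite geq_max expnS; apply/andP; split.
    by apply: leq_trans (size_scale_leq _ _) (leq_trans sa _); lia.
  apply: leq_trans (size_scale_leq _ _) _.
  by rewrite expr2; apply: leq_trans (size_polyMleq _ _) _; lia.
exists (e *: a + E *: a ^+ 2).
exists (e' *: a + p + c ^+ (l.+1 * g).-1 *: a ^+ 2); split=> //.
- rewrite addnS expnSr exprM -(subrK 1 ((1 + c *: z) ^+ (2 ^ _))) ea sqr_shift.
  rewrite two scalerDr !scalerA; congr (_ *: _ + _ *: _).
    by rewrite [in RHS]mulSn [in RHS]exprD; ring.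
  by rewrite /E -!exprD; congr (_ ^+ _); lia.
- have -> : E *: a ^+ 2 = c *: (c ^+ (l.+1 * g).-1 *: a ^+ 2).
    by rewrite scalerA -exprS prednK // muln_gt0.
  rewrite {1}e1 {1}(scalerDl a) scale1r {1}eap -!mul_polyC.
  by rewrite rmorphM /=; ring.
- move=> D; have [ltD|leD] := leqP l.+1 D.
    apply: size_mod_size; apply: leq_trans s2 _.
    by rewrite ltnS leq_mul2l leq_exp2l // ltD orbT.
  apply: size_modD; first exact: size_modZ.
  exists 0, (c ^+ (l.+1 * g - D.+1 * g) *: a ^+ 2); rewrite size_poly0 add0r.
  by rewrite scalerA -exprD subnKC // leq_mul2r leD orbT.
Qed.

End PowerSeries.

(* The minimal polynomial of [zeta - 1] for a primitive [2^(i+1)]-st root of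
   unity [zeta]. *)
Definition cyclo i : {poly int} := ('X + 1) ^+ (2 ^ i) + 1.

(** Eisenstein form at 2, by induction from [cyclo i.+1 = (cyclo i - 1) ^+ 2 + 1]. *)
Lemma cycloE i : exists q, cyclo i = 'X ^+ (2 ^ i) + 2 *: (1 + q * 'X).
Proof.
elim: i => [|i [q eq]].
  by exists 0; rewrite /cyclo !expr1 mul0r addr0 -addrA scaler_nat.
exists ('X ^+ (2 ^ i).-1 * (1 + 2 * (q * 'X)) + 2 * (1 + q * 'X) * q).
rewrite /cyclo expnSr exprM.
have -> : ('X + 1) ^+ (2 ^ i) = cyclo i - 1 :> {poly int}.
  by rewrite addrK.
rewrite eq; set g := (2 ^ i)%N.
have -> : 'X ^+ g = 'X * 'X ^+ g.-1 :> {poly int}.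
  by rewrite -exprS prednK // expn_gt0.
rewrite exprM -!mul_polyC (rmorph_nat polyC).
have -> : 'X ^+ g = 'X * 'X ^+ g.-1 :> {poly int}.
  by rewrite -exprS prednK // expn_gt0.
ring.
Qed.

Lemma size_cyclo_head i : size (('X + 1 : {poly int}) ^+ (2 ^ i)) = (2 ^ i).+1.
Proof. by have := size_exp_XsubC (2 ^ i) (-1 : int); rewrite polyCN opprK. Qed.

Lemma cyclo_monic i : cyclo i \is monic.
Proof.
rewrite /cyclo monicE lead_coefDl; last first.
  by rewrite size_poly1 size_cyclo_head ltnS expn_gt0.
by rewrite -monicE monic_exp // (monicXaddC 1).
Qed.

Lemma size_cyclo i : size (cyclo i) = (2 ^ i).+1.
Proof.
by rewrite /cyclo size_polyDl size_cyclo_head // size_poly1 ltnS expn_gt0.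
Qed.

Lemma cyclo_coef0 i : (cyclo i)`_0 = 2.
Proof. by rewrite -horner_coef0 !hornerE expr1n. Qed.

(** [cyclo i = w + 1] divides [w ^+ 2 - 1], which divides [cyclo j - 2]. *)
Lemma cyclo_mod i j : (i < j)%N -> exists r, cyclo j = 2 + r * cyclo i.
Proof.
move=> ltij; set w : {poly int} := ('X + 1) ^+ (2 ^ i).
have -> : cyclo j = (w ^+ 2) ^+ (2 ^ (j - i.+1)) + 1.
  by rewrite /w -!exprM -expnS -expnD addnS -addSn subnKC.
have [s es] : exists s, w ^+ 2 ^+ (2 ^ (j - i.+1)) - 1 = (w ^+ 2 - 1) * s.
  by exists (\sum_(k < 2 ^ (j - i.+1)) (w ^+ 2) ^+ k); rewrite subrX1.
exists ((w - 1) * s); rewrite -(subrK 1 (w ^+ 2 ^+ _)) es /cyclo -/w; ring.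
Qed.

Lemma int_regular (n : int) : n != 0 -> regular n.
Proof. by move=> n0 m /eqP; rewrite mulf_eq0 (negPf n0) => /eqP. Qed.

(* The hypothesis says that [2^(j - i)] divides the value of [f] at a root of
   [cyclo i]. The induction works because, for [i < j], [cyclo j] takes the
   value 2 at these roots. *)
Lemma dvd_coef0 j (f : {poly int}) :
  (forall i, (i < j)%N -> exists u v, f = 2 ^+ (j - i) *: u + v * cyclo i) ->
  exists m, f`_0 = 2 ^+ j * m.
Proof.
elim: j f => [|j IH] f hf; first by exists f`_0; rewrite mul1r.
have [u [v ef]] := hf j (leqnn _).
rewrite subSnn expr1 in ef.
(* Both at 0 and modulo [cyclo i], [cyclo j] equals 2, so [f] equals [2 (u + v)]: [u + v] inherits
   the hypothesis with one factor 2 less. *)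
have [|m em] := IH (u + v).
  move=> i lti; have [u' [v' ef']] := hf i (leqW lti).
  have [r er] := cyclo_mod lti.
  have e : (cyclo i + 2 *: 0) * (v' - v * r) =
      2 *: (u + v - 2 ^+ (j - i) *: u').
    rewrite scalerBr scalerA -exprS -subSn; last exact: ltnW.
    have -> : 2 ^+ (j.+1 - i) *: u' = f - v' * cyclo i by rewrite ef' addrK.
    by rewrite ef er -!mul_polyC (rmorph_nat polyC); ring.
  have [q eq] := monic_mod_cancel (cyclo_monic i) e.
  exists u', q; apply/eqP; rewrite -subr_eq0; apply/eqP.
  apply: (@regular_scaleI _ 2); first exact: int_regular.
  rewrite scaler0 opprD addrA scalerBr -e scaler0 addr0.
  by rewrite eq scalerAl mulrC subrr.
exists m; rewrite ef coefD coefZ coef0M cyclo_coef0.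
by rewrite exprS -mulrA -em coefD; ring.
Qed.

(** * The ring Z[zeta] and its uniformizer [zeta - 1] *)

Lemma quotient_by_monic (R : comNzRingType) (m : {poly R}) :
    m \is monic -> (1 < size m)%N ->
  exists (O : comNzRingType) (phi : {rmorphism {poly R} -> O}),
    [/\ phi m = 0, forall p, phi p = 0 -> exists q, p = q * m
      & forall z, exists p, z = phi p].
Proof.
(* [{poly %/ m}] is a quotient by [mk_monic m], which takes a default value unless [m] is monic of
   positive degree. *)
move=> mm sm; have em : mk_monic m = m by rewrite /mk_monic sm mm.
exists {poly %/ m}, (in_qpoly m); split.
- by apply: val_inj; rewrite /= em Pdiv.RingMonic.rmodpp.
- move=> p /(congr1 (@polyn _ _)) /=; rewrite em => e.
  exists (Pdiv.Ring.rdivp p m).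
  by rewrite {1}(Pdiv.RingMonic.rdivp_eq mm p) e addr0.
- move=> z; exists (polyn z); apply: val_inj; apply/esym.
  by apply: in_qpoly_small; apply: size_mk_monic.
Qed.

Section CyclotomicRing.
Variables (i : nat) (O : comNzRingType) (phi : {rmorphism {poly int} -> O}).
Hypothesis phi_cyclo : phi (cyclo i) = 0.
Hypothesis phi_eq0 : forall p, phi p = 0 -> exists q, p = q * cyclo i.
Hypothesis phi_surj : forall z, exists p, z = phi p.
Let g := (2 ^ i)%N.
Let c : O := phi 'X.

(** If ['X * p = q * cyclo i], comparing constant terms shows that [q] is a multiple of ['X], which
    then cancels. *)
Lemma cyclo_root_regular : regular c.
Proof.
move=> z; have [p ->] := phi_surj z; rewrite -rmorphM => /phi_eq0[q eq].
have : q`_0 * 2 = 0 by rewrite -(cyclo_coef0 i) -coef0M -eq coef0M coefX mul0r.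
move=> /eqP; rewrite mulf_eq0 orbF => /eqP q0.
have eq' : q = drop_poly 1 q * 'X.
  rewrite -{1}(poly_take_drop 1 q) expr1 [take_poly 1 q](_ : _ = 0) ?add0r //.
  by apply/polyP => k; rewrite coef_take_poly coef0; case: k.
have -> : p = drop_poly 1 q * cyclo i.
  apply: (@mulfI _ 'X); first by rewrite polyX_eq0.
  by rewrite eq {1}eq'; ring.
by rewrite rmorphM phi_cyclo mulr0.
Qed.

Lemma cyclo_root_order : (1 + c) ^+ g = -1.
Proof.
apply/eqP; rewrite -addr_eq0; apply/eqP.
rewrite -phi_cyclo /cyclo rmorphD rmorphXn rmorphD rmorph1.
by rewrite [phi _ + 1]addrC.
Qed.

(** Put [v = (1 + c) ^+ (2 ^ l)]. Since [(1 + c) ^+ g = -1], [1 + v = 1 - v ^+ (2 ^ (i - l)).+1] is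
    a multiple of [1 - v], so [1 - v ^+ 2] is a multiple of [(1 - v) ^+ 2]. *)
Let sub1_dvd l : (l <= i)%N ->
  exists u, 1 - (1 + c) ^+ (2 ^ l) = c ^+ (2 ^ l) * u.
Proof.
elim: l => [|l IH] ltl; first by exists (-1); rewrite !expr1; ring.
have [u eu] := IH (ltnW ltl).
have eg : (2 ^ l * (2 ^ (i - l)).+1 = 2 ^ l + g)%N.
  by rewrite mulnS -expnD subnKC // ltnW.
pose s := \sum_(k < (2 ^ (i - l)).+1) ((1 + c) ^+ (2 ^ l)) ^+ k.
have es : 1 + (1 + c) ^+ (2 ^ l) = c ^+ (2 ^ l) * u * s.
  rewrite -eu; apply: oppr_inj; rewrite -mulNr opprB -subrX1 -exprM eg exprD.
  by rewrite cyclo_root_order; ring.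
exists (u * (u * s)); rewrite expnSr !exprM.
set v := (1 + c) ^+ (2 ^ l) in eu es *.
have -> : 1 - v ^+ 2 = (1 - v) * (1 + v) by ring.
by rewrite eu es; ring.
Qed.

Lemma cyclo_root_ramified : exists t, c ^+ g = 2 * t.
Proof.
have [q eq] := cycloE i; exists (- phi (1 + q * 'X)).
apply/eqP; rewrite mulrN -addr_eq0; apply/eqP.
rewrite -phi_cyclo eq -mul_polyC (rmorph_nat polyC).
by rewrite [RHS]rmorphD rmorphXn rmorphM rmorph_nat.
Qed.

(** The case [l = i] of [sub1_dvd] gives [2 = c ^+ g * u]. The Eisenstein equation then gives
    [u = -1] modulo [c], which is 1 because [c] divides 2. *)
Lemma cyclo_root_two : exists e e', 2 = c ^+ g * e /\ e = 1 + c * e'.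
Proof.
have [u eu] := sub1_dvd (leqnn i); rewrite cyclo_root_order opprK -/g in eu.
have [q eq] := cycloE i.
have e1 : c ^+ g + 2 * (1 + phi q * c) = 0.
  rewrite -phi_cyclo eq -mul_polyC (rmorph_nat polyC) [RHS]rmorphD rmorphXn.
  by rewrite !(rmorphM, rmorphD, rmorph_nat, rmorph1).
have e2 : 1 + u * (1 + phi q * c) = 0.
  apply: (regularX (n := g) cyclo_root_regular).
  by rewrite -[RHS]e1 -[2]/(1 + 1) eu; ring.
have g0 : c ^+ g = c * c ^+ g.-1 by rewrite -exprS prednK // expn_gt0.
exists u, (- u * phi q - c ^+ g.-1 * u); split; first by rewrite -eu.
have eu2 : u = 1 - 2 - u * phi q * c.
  by apply/eqP; rewrite -subr_eq0 -[X in _ == X]e2; apply/eqP; ring.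
by rewrite [LHS]eu2 -[2]/(1 + 1) eu g0; ring.
Qed.

End CyclotomicRing.

(** * Divisibility of the values of [A] at [zeta - 1] *)

Lemma monicXnDXn (R : comNzRingType) g : (0 < g)%N ->
  ('X^g + 'X^(2 * g) : {poly R}) \is monic.
Proof.
move=> g0; rewrite addrC monicE lead_coefDl ?lead_coefXn //.
by rewrite !size_polyXn ltnS; lia.
Qed.

(** In the application [a], [M], [D] are [e - i - 1], [k - e], [j - i - 1]. The conclusion expresses
    in Z[T] that [2 ^+ D.+1] divides A(0, pi). *)
Lemma syzygy_value_dvd i a M D N (A B Q : {poly {poly int}}) :
    let g := (2 ^ i)%N in
    (2 * g * 2 ^ D + (M * g + D.+1 * g) <= N)%N ->
    ((1 + 'X%:P * 'X) ^+ (2 ^ (i + (a + M).+1)) - 1) * A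
      - 'X%:P * (((1 + 'X) ^+ (2 ^ (i + a.+1)) - 1) * B) = Q * 'X^N ->
  exists u v, map_poly (horner_eval 0) A = 2 ^+ D.+1 *: u + v * cyclo i.
Proof.
move=> g leN eQ.
have g0 : (0 < g)%N by rewrite expn_gt0.
have [|O [phi [phi0 phiI phiS]]] := quotient_by_monic (cyclo_monic i).
  by rewrite size_cyclo ltnS.
pose w : O := phi 'X.
have rw : regular w := cyclo_root_regular phi0 phiI phiS.
have [e [e' [two ee]]] := cyclo_root_two phi0 phiI phiS.
rewrite -/w -/g in two ee.
pose c : {poly O} := w%:P.
have rc : regular c by apply: regular_polyC.
have twoP : 2 = c ^+ g * e%:P.
  by rewrite -rmorphXn -rmorphM -two (rmorph_nat polyC).
have eeP : e%:P = 1 + c * e'%:P by rewrite ee rmorphD rmorphM.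
have [al [p [eal alE _ sal]]] := two_power_high 'X twoP eeP (a + M).
have [be [q [ebe beE _ sbe]]] := two_power_high 1 twoP eeP a.
rewrite -/g scale1r in eal alE sal ebe beE sbe.
(* With X = xT and Y = T, scaling the outer variable T by [c] scales both X and Y. *)
pose psi (P : {poly {poly int}}) :=
  map_poly (map_poly (intr : int -> O)) P \Po (c *: 'X).
have psiM P P' : psi (P * P') = psi P * psi P' by rewrite /psi !rmorphM.
have psiB P P' : psi (P - P') = psi P - psi P' by rewrite /psi !rmorphB.
have psi1 : psi 1 = 1 by rewrite /psi !rmorph1.
have psiD P P' : psi (P + P') = psi P + psi P' by rewrite /psi !rmorphD.
have psiXn P n : psi (P ^+ n) = psi P ^+ n by rewrite /psi !rmorphXn.
have psix : psi 'X%:P = 'X%:P by rewrite /psi map_polyC /= map_polyX comp_polyC.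
have psiX : psi 'X = c *: 'X by rewrite /psi map_polyX comp_polyX.
have szX n P : size_mod (c ^+ n) n (psi P) by apply: size_mod_comp.
have eN : c ^+ (a.+2 * g) *:
    (c ^+ (M * g) *: (al * psi A) - be * ('X%:P * psi B)) =
    c ^+ N *: psi Q * 'X^N.
  rewrite -[RHS]scalerAl [RHS]scalerAr -exprZn -psiX -psiXn -psiM -eQ.
  rewrite !(psiB, psiM, psiD, psi1, psiXn, psix, psiX).
  have -> : 'X%:P * (c *: 'X) = c *: ('X *: 'X) :> {poly {poly O}}.
    by rewrite mul_polyC !scalerA mulrC.
  rewrite eal ebe scalerBr scalerA -exprD -mulnDl -!mul_polyC.
  have -> : (a.+2 + M = (a + M).+2)%N by lia.
  ring.
have [Q' eQ'] := scale_dvdXn (regularX (n := a.+2 * g) rc) eN.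
have wX : (1 + w) ^+ g = -1 by apply: cyclo_root_order.
(* [1 + w] is zeta, whose power [2 ^ (i + a.+1)] is 1. *)
have be1 : be.[1] = 0.
  apply: (regularX (n := a.+2 * g) rc); rewrite -hornerZ -ebe.
  rewrite !hornerE expnD exprM -[1 + c]/(1%:P + w%:P) -rmorphD -rmorphXn wX.
  by rewrite expnS exprM rmorphN sqrrN !expr1n subrr.
(* Modulo [c], [al.[1]] is the monic polynomial ['X^g + 'X^(2 * g)] in the inner variable. *)
have al1 x v : al.[1] * x = c * v -> exists x', x = c * x'.
  rewrite alE !hornerE => e1.
  have [|x' ->] := @monic_mod_cancel _ w _ p.[1] x v (monicXnDXn _ g0).
    by rewrite -!mul_polyC.
  by exists x'; rewrite mul_polyC.
have mb : ('X^g + 'X^(2 * g) : {poly {poly O}}) \is monic by apply: monicXnDXn.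
have sb : size_mod c (2 * g).+1 be.
  exists ('X^g + 'X^(2 * g)), q; split=> //.
  apply: leq_trans (size_polyD _ _) _.
  by rewrite !size_polyXn geq_max ltnS leqnn andbT; lia.
have h1 : (2 * g + M * g <= N)%N.
  apply: leq_trans leN; apply: leq_add; last exact: leq_addr.
  by rewrite leq_pmulr // expn_gt0.
have sXB n : size_mod (c ^+ n) n ('X%:P * psi B).
  by rewrite mul_polyC; apply: size_modZ.
have [x ex] := truncated_syzygy rc mb beE sb (sal D) (sbe D) be1 al1
  (fun n => szX n A) sXB h1 leN eQ'.
have [t et] := cyclo_root_ramified phi0.
have eval0 (P : {poly {poly int}}) :
    (psi P).[1].[0] = phi (map_poly (horner_eval 0) P).
  rewrite horner_comp !hornerE.
  elim/poly_ind: P => [|P r IH]; first by rewrite !rmorph0 !horner0.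
  rewrite !rmorphD !rmorphM /= !map_polyX !map_polyC /= !hornerE IH /=.
  congr (_ + _).
  rewrite horner_coef0 coef_map /= horner_evalE horner_coef0.
  by rewrite -{2}[r`_0]intz (rmorph_int polyC) rmorph_int.
(* Setting the inner variable to 0 means X = 0; then [c ^+ g = 2 * t] turns powers of [c] into
   powers of 2. *)
have := congr1 (fun P => P.[0]) ex.
rewrite eval0 hornerM -rmorphXn hornerC mulnC exprM et.
have [u ->] := phiS x.[0]; rewrite exprMn -mulrA => e2.
have [u' eu'] := phiS (t ^+ D.+1 * phi u).
move: e2; rewrite eu' => e2.
have [|v ev] := phiI (map_poly (horner_eval 0) A - 2 ^+ D.+1 *: u').
  rewrite -mul_polyC rmorphXn (rmorph_nat polyC).
  rewrite rmorphB rmorphM rmorphXn rmorph_nat.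
  by rewrite e2 subrr.
by exists u', v; rewrite -ev addrC subrK.
Qed.

Lemma syzygy_coef0_dvd k e j (A B Q : {poly {poly int}}) :
    (e <= k)%N -> (0 < j <= e)%N ->
    ((1 + 'X%:P * 'X) ^+ (2 ^ k) - 1) * A
      - 'X%:P * (((1 + 'X) ^+ (2 ^ e) - 1) * B) =
    Q * 'X^(2 ^ (j - 1) * (k - e + 3)) ->
  exists m, (A`_0)`_0 = 2 ^+ j * m.
Proof.
move=> leek /andP[j0 leje] eQ.
have [i ltij|m em] := @dvd_coef0 j (map_poly (horner_eval 0) A); last first.
  by exists m; rewrite -em coef_map /= horner_evalE horner_coef0.
have -> : (j - i = (j - i.+1).+1)%N by lia.
apply: (@syzygy_value_dvd i (e - i.+1) (k - e) (j - i.+1)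
  (2 ^ (j - 1) * (k - e + 3)) A B Q); last first.
  by rewrite -eQ; congr (_ * _ - _ * (_ * _)); congr (_ ^+ (2 ^ _) - 1); lia.
(* With [g = 2 ^ i] and [h = 2 ^ (j - i.+1)] the bound is [2gh + (k - e)g + (j - i)g <= gh(k - e +
   3)]. It follows from [1 <= j - i <= h], and explains the 3 as 2 + 1. *)
have -> : (2 ^ (j - 1) = 2 ^ i * 2 ^ (j - i.+1))%N.
  by rewrite -expnD; congr (_ ^ _)%N; lia.
have : (j - i.+1 < 2 ^ (j - i.+1))%N by apply: ltn_expl.
have := expn_gt0 2 i.
move: (2 ^ i)%N (2 ^ _)%N (k - e)%N (j - i.+1)%N => g h M D; nia.
Qed.

(** * Duality over the integers *)

Lemma sum_enum_val (V : nmodType) (I : finType) (F : I -> V) :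
  \sum_i F i = \sum_(i < #|I|) F (enum_val i).
Proof.
rewrite (reindex_onto enum_val enum_rank) /=; last first.
  by move=> i _; apply: enum_rankK.
by apply: eq_bigl => i; rewrite enum_valK eqxx.
Qed.

(** Homomorphisms to the groups Z/K separate the points of a finitely generated abelian group. Smith
    normal form splits the group into cyclic summands, and the columns of [invmx R] serve as test
    functions [F]. *)
Lemma int_duality (V : zmodType) (I J : finType) (G : I -> V)
    (P : J -> I -> int) (t : I -> int) :
    (forall r, \sum_i G i *~ P r i = 0) ->
    (forall K : int, K != 0 -> forall F : I -> int,
       (forall r, exists q, \sum_i P r i * F i = K * q) ->
       exists q, \sum_i t i * F i = K * q) ->
  \sum_i G i *~ t i = 0.
Proof.
move=> GP PF; set n := #|I|; set m := #|J|.
pose G' (i : 'I_n) := G (enum_val i).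
pose ev p (X : 'M[int]_(p, n)) s := \sum_i G' i *~ X s i.
have evM p q (X : 'M_(p, q)) Y s : ev p (X *m Y) s = \sum_r ev q Y r *~ X s r.
  rewrite /ev; under eq_bigr do rewrite mxE mulrz_sumr.
  rewrite exchange_big; apply: eq_bigr => r _; rewrite mulrz_suml.
  by apply: eq_bigr => i _; rewrite mulrC mulrzA.
pose M : 'M_(m, n) := \matrix_(r, i) P (enum_val r) (enum_val i).
pose T : 'rV_n := \row_i t (enum_val i).
have -> : \sum_i G i *~ t i = ev 1 T 0.
  by rewrite sum_enum_val; apply: eq_bigr => i _; rewrite mxE.
have evM0 r : ev m M r = 0.
  rewrite -[RHS](GP (enum_val r)) sum_enum_val.
  by apply: eq_bigr => i _; rewrite mxE.
have [L uL [R uR [d _ eM]]] := int_Smith_normal_form M.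
set D := \matrix_(_, _) _ in eM.
have -> : T = (T *m invmx R) *m R by rewrite mulmxKV.
rewrite evM big1 // => j _.
(* A column without a diagonal entry counts as a free summand. *)
pose dj := if (j < m)%N then d`_j else 0.
have dj0 : ev n R j *~ dj = 0.
  rewrite /dj; case: ltnP => [ltjm|_]; last by rewrite mulr0z.
  have : ev m (invmx L *m M) (Ordinal ltjm) = 0.
    by rewrite evM big1 // => s _; rewrite evM0 mul0rz.
  rewrite eM -mulmxA mulKmx // evM (bigD1 j) //= mxE eqxx mulr1n => <-.
  rewrite big1 ?addr0 // => s; rewrite eq_sym => /negPf nsj.
  by rewrite mxE (_ : _ == _ = false) ?mulr0n ?mulr0z.
pose F i := invmx R (enum_rank i) j.
have PF' r : exists q, \sum_i P r i * F i = dj * q.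
  have -> : \sum_i P r i * F i = (M *m invmx R) (enum_rank r) j.
    rewrite mxE sum_enum_val; apply: eq_bigr => i _.
    by rewrite /F mxE enum_rankK enum_valK.
  rewrite eM mulmxK // mxE /dj; case: ltnP => [ltjm|lemj].
    exists (L (enum_rank r) (Ordinal ltjm)).
    rewrite (bigD1 (Ordinal ltjm)) //= mxE eqxx mulr1n mulrC.
    rewrite big1 ?addr0 // => s nsj.
    rewrite mxE (_ : _ == _ = false) ?mulr0n ?mulr0 //.
    by apply: contraNF nsj => /eqP e; apply/eqP/val_inj.
  exists 0; rewrite mulr0 big1 // => s _.
  rewrite mxE (_ : _ == _ = false) ?mulr0n ?mulr0 //.
  by apply/eqP => e; have := ltn_ord s; rewrite e ltnNge lemj.
have tF : \sum_i t i * F i = (T *m invmx R) 0 j.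
  rewrite mxE sum_enum_val; apply: eq_bigr => i _.
  by rewrite /F mxE enum_valK.
have [dj_eq0|dj_neq0] := eqVneq dj 0; last first.
  have [q] := PF _ dj_neq0 _ PF'.
  by rewrite tF => ->; rewrite mulrzA dj0 mul0rz.
(* On a free summand every [K] is allowed; one exceeding the absolute value of the coordinate forces
   it to be 0. *)
have [|r|q] := PF (`|(T *m invmx R) 0 j| + 1) _ F.
- by rewrite gt_eqF // ltr_wpDl.
- by have [q ->] := PF' r; exists 0; rewrite dj_eq0 mul0r mulr0.
rewrite tF => /(congr1 (fun x => `|x|)); rewrite normrM.
set x := (_ *m _) _ _ => ex.
suff -> : x = 0 by rewrite mulr0z.
by move: ex; have [->|q0] := eqVneq q 0; nia.
Qed.

(** * Relations in [ku_mod] and in the tensor product *)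

Lemma sum_ord_trunc (V : nmodType) (F : nat -> V) n m : (n <= m)%N ->
  (forall s, (n <= s)%N -> F s = 0) -> \sum_(s < m) F s = \sum_(s < n) F s.
Proof.
move=> /subnKC <- F0.
rewrite big_split_ord /= [X in _ + X]big1 ?addr0 // => s _.
by rewrite F0 // leq_addr.
Qed.

Lemma sum_ord_conv (V : zmodType) (X : nat -> V) (a : nat -> int) b n :
    (b <= n)%N ->
  \sum_(i < n.+1) X i *~ (if (i <= b)%N then a (b - i)%N else 0) =
  \sum_(s < b.+1) X (b - s)%N *~ a s.
Proof.
move=> lebn.
rewrite (@sum_ord_trunc _
  (fun i => X i *~ (if (i <= b)%N then a (b - i)%N else 0)) b.+1) //.
  rewrite (reindex_inj rev_ord_inj) /=; apply: eq_bigr => s _.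
  by rewrite subSS leq_subr subKn // -ltnS.
by move=> s ltbs; rewrite leqNgt ltbs mulr0z.
Qed.

(** The two ranges of summation agree up to zeros: generators of negative index vanish, and so does
    ['C(2 ^ r, s.+1)] for [s >= 2 ^ r]. *)
Lemma ku_gen_rel r i :
  \sum_(s < i.+1) ('C(2 ^ r, s.+1)%:R * v1 ^+ s) *: ku_gen r (i - s) = 0.
Proof.
pose F s := ('C(2 ^ r, s.+1)%:R * v1 ^+ s) *:
  quot_proj (@ku_rel r) (ku_free_gen (i%:Z - s%:Z)).
transitivity (\sum_(s < i.+1) F s).
  apply: eq_bigr => s _; rewrite /F subzn ?leq_ord //.
transitivity (\sum_(s < 2 ^ r) F s).
  rewrite -(@sum_ord_trunc _ F i.+1 (i.+1 + 2 ^ r)) ?leq_addr //; last first.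
    move=> s lts; rewrite /F -opprB subzn 1?ltnW //.
    case E : (s - i)%N => [|d]; first by have := subn_gt0 i s; rewrite E lts.
    by rewrite -NegzE /= linear0 scaler0.
  apply: sum_ord_trunc; first exact: leq_addl.
  by move=> s les; rewrite /F bin_small // mul0r scale0r.
rewrite /F; under eq_bigr do rewrite -linearZ.
rewrite -linear_sum -(linear0 (quot_proj (@ku_rel r))); apply/quot_projP.
by rewrite subr0; apply: mem_span; exists i.
Qed.

Section Tens.
Variables (R : comNzRingType) (M N : lmodType R).

Lemma tens0l (n : N) : tens (0 : M) n = 0.
Proof.
apply: (@addrI _ (tens (0 : M) n)); rewrite addr0.
by have := tens_linearl n 1 (0 : M) 0; rewrite !scale1r addr0 => <-.
Qed.

Lemma tens0r (m : M) : tens m (0 : N) = 0.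
Proof.
apply: (@addrI _ (tens m (0 : N))); rewrite addr0.
by have := tens_linearr m 1 (0 : N) 0; rewrite !scale1r addr0 => <-.
Qed.

Lemma tens_suml (n : N) (k : nat) (a : nat -> R) (x : nat -> M) :
  \sum_(s < k) a s *: tens (x s) n = tens (\sum_(s < k) a s *: x s) n.
Proof.
elim: k => [|k IH]; first by rewrite !big_ord0 tens0l.
by rewrite !big_ord_recr /= addrC [in RHS]addrC IH tens_linearl.
Qed.

Lemma tens_sumr (m : M) (k : nat) (a : nat -> R) (x : nat -> N) :
  \sum_(s < k) a s *: tens m (x s) = tens m (\sum_(s < k) a s *: x s).
Proof.
elim: k => [|k IH]; first by rewrite !big_ord0 tens0r.
by rewrite !big_ord_recr /= addrC [in RHS]addrC IH tens_linearr.
Qed.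

End Tens.

(** * Dual functions as truncated polynomials *)

Lemma coefD1Xn (R : comNzRingType) (y : R) m l :
  ((1 + y%:P * 'X) ^+ m)`_l = y ^+ l *+ 'C(m, l).
Proof.
rewrite addrC exprD1n coef_sum.
transitivity (\sum_(i < m.+1) (if l == i then y ^+ l *+ 'C(m, l) else 0)).
  apply: eq_bigr => i _; rewrite coefMn exprMn -rmorphXn coefCM coefXn.
  by case: eqVneq => [->|_]; rewrite ?mulr1 ?mulr0 ?mul0rn.
have [ltlm|leml] := ltnP l m.+1.
  rewrite (bigD1 (Ordinal ltlm)) //= eqxx big1 ?addr0 // => i /eqP ni.
  by case: eqP => // e; case: ni; apply: val_inj.
by rewrite bin_small // mulr0n big1 // => i _; rewrite if_same.
Qed.

Lemma coef_geomM (R : comNzRingType) (y : R) m (P : {poly R}) D :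
  (((1 + y%:P * 'X) ^+ m - 1) * P)`_D.+1 =
  \sum_(s < D.+1) (y ^+ s.+1 *+ 'C(m, s.+1)) * P`_(D - s).
Proof.
rewrite coefM big_ord_recl coefB coefD1Xn bin0 coef1 eqxx subrr mul0r add0r.
by apply: eq_bigr => s _; rewrite coefB coefD1Xn coef1 subr0.
Qed.

(* [X^b Y^c] is represented by [x^b T^(b+c)], with [x] the inner and [T] the
   outer variable, so that [(X, Y)^n] becomes the ideal of [T^n]. *)
Definition homog_poly n (F : nat -> nat -> int) : {poly {poly int}} :=
  \poly_(D < n.+1) \poly_(b < D.+1) F b (D - b)%N.

Lemma coef_homog_poly n F D b : (D <= n)%N ->
  (homog_poly n F)`_D`_b = if (b <= D)%N then F b (D - b)%N else 0.
Proof. by move=> leD; rewrite coef_poly ltnS leD coef_poly ltnS. Qed.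

Lemma poly_eq_modXn (R : nzRingType) N (p q : {poly R}) :
  (forall l, (l < N)%N -> p`_l = q`_l) -> exists r, p = q + r * 'X^N.
Proof.
move=> e; exists (drop_poly N p - drop_poly N q).
have et : take_poly N p = take_poly N q.
  by apply/polyP => l; rewrite !coef_take_poly; case: ifP => // /e.
rewrite -[LHS](poly_take_drop N p) -{1}[q](poly_take_drop N q) et.
by rewrite mulrBl addrA addrAC addrK.
Qed.

Section Transfer.
Variables (n m : nat) (F A : nat -> nat -> int) (K : int).

(** The sum is a coefficient of ((1 + Y)^m - 1)/Y times [F]. Multiplying by Y = T avoids the
    division and raises the truncation to [n.+2]. *)
Lemma geomM_T :
  (forall b c, (b + c <= n)%N ->
     \sum_(s < c.+1) F b (c - s)%N *~ ('C(m, s.+1))%:Z = K * A b c) ->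
  exists Q : {poly {poly int}}, ((1 + 'X) ^+ m - 1) * homog_poly n F =
    K%:P%:P * ('X * homog_poly n A) + Q * 'X^(n.+2).
Proof.
move=> FA.
have -> : 1 + 'X = 1 + 1%:P * 'X :> {poly {poly int}} by rewrite mul1r.
apply: poly_eq_modXn => -[_|D].
  by rewrite !coef0M coefB coefD1Xn bin0 coef1 coefX subrr mul0r mul0r mulr0.
rewrite !ltnS => leDn; rewrite coefCM coefXM /= coef_geomM; apply/polyP => b.
rewrite coefCM coef_homog_poly // coef_sum.
pose f s :=
  (if (b + s <= D)%N then F b (D - b - s)%N else 0) *~ ('C(m, s.+1))%:Z.
have coefE s : (s <= D)%N ->
    (1 ^+ s.+1 *+ 'C(m, s.+1) * (homog_poly n F)`_(D - s))`_b = f s.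
  move=> les; rewrite expr1n mulrnAl mul1r coefMn.
  rewrite coef_homog_poly //; last first.
    by rewrite (leq_trans (leq_subr _ _)).
  by rewrite /f leq_subRL // addnC subnAC.
under eq_bigr => s _ do rewrite coefE -1?ltnS //.
have [lebD|ltDb] := leqP b D; last first.
  rewrite mulr0 big1 // => s _.
  by rewrite /f ifF ?mul0rz //; lia.
rewrite -FA ?subnKC //.
rewrite (@sum_ord_trunc _ f (D - b).+1).
- by apply: eq_bigr => s _; rewrite /f -leq_subRL // leq_ord.
- by rewrite ltnS leq_subr.
- by move=> s lts; rewrite /f ifF ?mul0rz //; lia.
Qed.

Lemma geomM_xT :
  (forall b c, (b + c <= n)%N ->
     \sum_(s < b.+1) F (b - s)%N c *~ ('C(m, s.+1))%:Z = K * A b c) ->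
  exists Q : {poly {poly int}}, ((1 + 'X%:P * 'X) ^+ m - 1) * homog_poly n F =
    K%:P%:P * ('X%:P * 'X * homog_poly n A) + Q * 'X^(n.+2).
Proof.
move=> FA; apply: poly_eq_modXn => -[_|D].
  rewrite -mulrA !coef0M coefB coefD1Xn bin0 coef1 coefX subrr.
  by rewrite !(mul0r, mulr0).
rewrite !ltnS => leDn; rewrite coefCM -mulrA coefCM coefXM /= coef_geomM.
apply/polyP => b.
rewrite coefCM coefXM coef_sum.
(* The factor ['X ^+ s.+1] coming from X = xT shifts the inner degree, whence [s < b]. *)
pose f s := (if (s < b <= D.+1)%N then F (b - s.+1)%N (D.+1 - b)%N else 0)
  *~ ('C(m, s.+1))%:Z.
have coefE s : (s <= D)%N ->
    ('X ^+ s.+1 *+ 'C(m, s.+1) * (homog_poly n F)`_(D - s))`_b = f s.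
  move=> les; rewrite /f mulrnAl coefMn coefXnM ltnS.
  rewrite coef_homog_poly; last by lia.
  have [lebs|ltsb] := leqP b s; first by rewrite mul0rn mul0rz.
  rewrite andTb.
  have -> : (b - s.+1 <= D - s)%N = (b <= D.+1)%N by lia.
  by case: ifP => // lebD; congr (F _ _ *+ _); lia.
under eq_bigr => s _ do rewrite coefE -1?ltnS //.
case: b @f {coefE} => [|b] f.
  by rewrite mulr0 big1 // => s _; rewrite /f mul0rz.
rewrite coef_homog_poly //; have [lebD|ltDb] := leqP b D; last first.
  by rewrite mulr0 big1 // => s _; rewrite /f ifF ?mul0rz //; lia.
rewrite -FA ?subnKC //.
rewrite (@sum_ord_trunc _ f b.+1) //.
- by apply: eq_bigr => s _; rewrite /f ltn_ord ltnS lebD !subSS.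
- by move=> s lts; rewrite /f ltnNge lts mul0rz.
Qed.

End Transfer.

Lemma geom_dvdX (R : comNzRingType) (y : {poly R}) m :
  exists r, (1 + y * 'X) ^+ m - 1 = 'X * r.
Proof.
exists (y * \sum_(i < m) (1 + y * 'X) ^+ i).
by rewrite subrX1 [1 + _ - 1]addrC addKr; ring.
Qed.

(** Eliminating [F] from [b F = K Y A] and [a F = K X B] makes [K T (a A - x b B)] vanish modulo
    [T^(n+3)], the extra T coming from [a] and [b], which are multiples of T. Then T and [K]
    cancel. *)
Lemma homog_syzygy n m m' (F A B : nat -> nat -> int) (K : int) : K != 0 ->
  (forall b c, (b + c <= n)%N ->
     \sum_(s < c.+1) F b (c - s)%N *~ ('C(m, s.+1))%:Z = K * A b c) ->
  (forall b c, (b + c <= n)%N ->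
     \sum_(s < b.+1) F (b - s)%N c *~ ('C(m', s.+1))%:Z = K * B b c) ->
  exists Q, ((1 + 'X%:P * 'X) ^+ m' - 1) * homog_poly n A
    - 'X%:P * (((1 + 'X) ^+ m - 1) * homog_poly n B) = Q * 'X^(n.+2).
Proof.
move=> K0 /geomM_T[Q1 e1] /geomM_xT[Q2 e2].
have [r er] := geom_dvdX ('X%:P : {poly {poly int}}) m'.
have [t et] := geom_dvdX (1 : {poly {poly int}}) m; rewrite mul1r in et.
set a := (1 + 'X%:P * 'X) ^+ m' - 1 in er e2 *.
set b := (1 + 'X) ^+ m - 1 in et e1 *.
have rK : regular (K%:P : {poly int}) by apply/regular_polyC/int_regular.
apply: (scale_dvdXn rK (q := t * Q2 - r * Q1)).
apply: (@mulfI _ 'X); first by rewrite polyX_eq0.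
rewrite -mul_polyC.
have -> : 'X * (K%:P%:P * (a * homog_poly n A - 'X%:P * (b * homog_poly n B))) =
    a * (K%:P%:P * ('X * homog_poly n A)) -
    b * (K%:P%:P * ('X%:P * 'X * homog_poly n B)) by ring.
have -> : K%:P%:P * ('X * homog_poly n A) = b * homog_poly n F - Q1 * 'X^(n.+2).
  by rewrite e1 addrK.
have -> : K%:P%:P * ('X%:P * 'X * homog_poly n B) =
    a * homog_poly n F - Q2 * 'X^(n.+2).
  by rewrite e2 addrK.
by rewrite er et; ring.
Qed.

(** This is [int_duality] on a square of indices, the boolean telling the two families of relations
    apart; rows outside the triangle [b + c <= n] are set to zero. *)
Lemma triangle_duality (V : zmodType) n m m' (G : nat -> nat -> V) (a : int) :
    (forall b c, (b + c <= n)%N ->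
       \sum_(s < b.+1) G (b - s)%N c *~ ('C(m', s.+1))%:Z = 0) ->
    (forall b c, (b + c <= n)%N ->
       \sum_(s < c.+1) G b (c - s)%N *~ ('C(m, s.+1))%:Z = 0) ->
    (forall (K : int) F, K != 0 ->
       (forall b c, (b + c <= n)%N ->
          exists q,
            \sum_(s < b.+1) F (b - s)%N c *~ ('C(m', s.+1))%:Z = K * q) ->
       (forall b c, (b + c <= n)%N ->
          exists q,
            \sum_(s < c.+1) F b (c - s)%N *~ ('C(m, s.+1))%:Z = K * q) ->
       exists q, a * F 0%N 0%N = K * q) ->
  G 0%N 0%N *~ a = 0.
Proof.
move=> Gx Gy dual; pose I := ('I_n.+1 * 'I_n.+1)%type.
pose w l (i s : nat) : int := if (i <= s)%N then 'C(l, (s - i).+1) else 0%N.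
pose P (r : bool * I) (i : I) : int :=
  if (r.2.1 + r.2.2 <= n)%N then
    if r.1 then if i.2 == r.2.2 then w m' i.1 r.2.1 else 0
    else if i.1 == r.2.1 then w m i.2 r.2.2 else 0
  else 0.
have sumP (W : zmodType) (H : nat -> nat -> W) (r : bool * I) :
    (r.2.1 + r.2.2 <= n)%N ->
    \sum_(i : I) H i.1 i.2 *~ P r i =
    if r.1 then \sum_(s < r.2.1.+1) H (r.2.1 - s)%N r.2.2 *~ ('C(m', s.+1))%:Z
    else \sum_(s < r.2.2.+1) H r.2.1 (r.2.2 - s)%N *~ ('C(m, s.+1))%:Z.
  have wE l s i : w l i s = if (i <= s)%N then ('C(l, (s - i).+1))%:Z else 0.
    by rewrite /w; case: ifP.
  case: r => -[] [b c] /= lebc; rewrite /P /= lebc.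
    rewrite -(pair_bigA _ (fun b' c' : 'I_n.+1 =>
      H b' c' *~ (if c' == c then w m' b' b else 0))) /=.
    rewrite -(sum_ord_conv (H^~ c) (fun s => ('C(m', s.+1))%:Z) (leq_ord b)).
    apply: eq_bigr => b' _; rewrite (bigD1 c) //= eqxx wE big1 ?addr0 //.
    by move=> c' /negPf ->; rewrite mulr0z.
  rewrite -(pair_bigA _ (fun b' c' : 'I_n.+1 =>
    H b' c' *~ (if b' == b then w m c' c else 0))) /= exchange_big /=.
  rewrite -(sum_ord_conv (H b) (fun s => ('C(m, s.+1))%:Z) (leq_ord c)).
  apply: eq_bigr => c' _; rewrite (bigD1 b) //= eqxx wE big1 ?addr0 //.
  by move=> b' /negPf ->; rewrite mulr0z.
pose t (i : I) : int := if i == (ord0, ord0) then a else 0.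
have := @int_duality _ _ _ (fun i : I => G i.1 i.2) P t.
rewrite (bigD1 (ord0, ord0)) //= big1 ?addr0; last first.
  by move=> i /negPf ni; rewrite /t ni mulr0z.
rewrite {1}/t /=; apply=> [r|K K0 F' PF].
  have [ler|ltr] := leqP (r.2.1 + r.2.2) n; last first.
    by rewrite big1 // => i _; rewrite /P (leqNgt (r.2.1 + _)) ltr mulr0z.
  by rewrite sumP //; case: ifP => _; [apply: Gx | apply: Gy].
pose F b c := F' (inord b, inord c).
have PFE r : \sum_(i : I) P r i * F' i = \sum_(i : I) F i.1 i.2 *~ P r i.
  by apply: eq_bigr => -[b c] _; rewrite /F /= !inord_val mulrC mulrzz.
rewrite (bigD1 (ord0, ord0)) //= big1 ?addr0; last first.
  by move=> i /negPf ni; rewrite /t ni mul0r.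
have -> : F' (ord0, ord0) = F 0%N 0%N.
  by congr F'; congr (_, _); apply: val_inj; rewrite /= inordK.
rewrite /t /=; apply: dual => // b c lebc.
  have [q] := PF (true, (inord b, inord c)).
  by rewrite PFE sumP /= !inordK ?ltnS //; [exists q | lia..].
have [q] := PF (false, (inord b, inord c)).
by rewrite PFE sumP /= !inordK ?ltnS //; [exists q | lia..].
Qed.

Theorem theorem2p1 (k e : nat) (he : (1 <= e)%N) (hke : (e <= k)%N)
    (j : nat) (hj : (j <= e)%N) :
  eps k e j *: toral k e = 0.
Proof.
pose a l s : ku_coef := 'C(2 ^ l, s.+1)%:R * v1 ^+ s.
pose z b c : toral_summand k e := tens (ku_gen k b) (ku_gen e c).
have relx b c : \sum_(s < b.+1) a k s *: z (b - s)%N c = 0.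
  rewrite (tens_suml _ _ (a k) (fun s => ku_gen k (b - s))).
  by rewrite ku_gen_rel tens0l.
have rely b c : \sum_(s < c.+1) a e s *: z b (c - s)%N = 0.
  rewrite (tens_sumr _ _ (a e) (fun s => ku_gen e (c - s))).
  by rewrite ku_gen_rel tens0r.
case: j hj => [|j] hj.
  (* The relation of index 0 in the second factor is [2 ^ e (0) = 0]. *)
  by have := rely 0%N 0%N; rewrite big_ord1 /a expr0 mulr1 bin1.
rewrite /eps /= -/(z 0%N 0%N); set n := (_ - 2)%N.
(* The product is at least 3, so the subtraction defining [n] is not truncated. *)
have en : n.+2 = (2 ^ (j.+1 - 1) * (k - e + 3))%N.
  have : (0 < 2 ^ (j.+1 - 1))%N by rewrite expn_gt0.
  by rewrite /n; move: (2 ^ _)%N => h; nia.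
(* Powers of [v1] bring all generators to degree [n], where the relations have integer
   coefficients. *)
pose g b c : toral_summand k e := v1 ^+ (n - (b + c)) *: z b c.
have -> : ((2 ^ (e - j.+1))%:R * v1 ^+ n) *: z 0%N 0%N =
    g 0%N 0%N *~ (2 ^+ (e - j.+1)).
  by rewrite /g subn0 scalerMzl -natrX natz -pmulrn mulr_natl.
have shift i i' l s : (s + i = i')%N -> (i' <= n)%N ->
    v1 ^+ (n - i) *~ ('C(2 ^ l, s.+1))%:Z = v1 ^+ (n - i') * a l s.
  move=> ei lei; rewrite /a mulrCA -exprD mulr_natl -pmulrn.
  by congr (_ ^+ _ *+ _); lia.
apply: (@triangle_duality _ n (2 ^ e) (2 ^ k))
  => [b c lebc|b c lebc|K F K0 Fx Fy].
- have /(congr1 (fun u => v1 ^+ (n - (b + c)) *: u)) := relx b c.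
  rewrite scaler0 scaler_sumr; apply: etrans; apply: eq_bigr => s _.
  have les := leq_ord s.
  by rewrite /g scalerMzl scalerA; congr (_ *: _); apply: shift => //; lia.
- have /(congr1 (fun u => v1 ^+ (n - (b + c)) *: u)) := rely b c.
  rewrite scaler0 scaler_sumr; apply: etrans; apply: eq_bigr => s _.
  have les := leq_ord s.
  by rewrite /g scalerMzl scalerA; congr (_ *: _); apply: shift => //; lia.
pose A b c := ((\sum_(s < c.+1) F b (c - s)%N *~ ('C(2 ^ e, s.+1))%:Z) %/ K)%Z.
pose B b c := ((\sum_(s < b.+1) F (b - s)%N c *~ ('C(2 ^ k, s.+1))%:Z) %/ K)%Z.
have EA b c : (b + c <= n)%N ->
    \sum_(s < c.+1) F b (c - s)%N *~ ('C(2 ^ e, s.+1))%:Z = K * A b c.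
  by rewrite /A => /Fy[q ->]; rewrite mulKz.
have EB b c : (b + c <= n)%N ->
    \sum_(s < b.+1) F (b - s)%N c *~ ('C(2 ^ k, s.+1))%:Z = K * B b c.
  by rewrite /B => /Fx[q ->]; rewrite mulKz.
have [Q eQ] := homog_syzygy K0 EA EB.
rewrite en in eQ.
have [|m em] := syzygy_coef0_dvd hke _ eQ; first by rewrite hj.
(* At (0, 0) this reads [2 ^ e F(0, 0) = K A(0, 0)]; cancelling [2 ^+ j.+1] leaves the required
   multiple of [K]. *)
have := EA 0%N 0%N isT; rewrite big_ord1 bin1.
have -> : A 0%N 0%N = 2 ^+ j.+1 * m by rewrite -em coef_homog_poly.
move=> eF; exists m; apply: (@mulfI _ (2 ^+ j.+1)); first by rewrite expf_neq0.
rewrite mulrA -exprD subnKC // [RHS]mulrCA -eF mulrzz mulrC.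
by rewrite -natrX natz.
Qed.
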